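(* Let $\mathcal{H}$ be a Hilbert space and suppose $\mathsf{P}_1,\dots,\mathsf{P}_n$ are orthogonal projections with respect to the inner product of $\mathcal{H}$. There is an absolute constant $c>0$ such that the following holds for any $\delta>0$: 1. Suppose that for every permutation $\sigma:[n]\to[n]$ it holds that $\|\mathsf{P}_{\sigma(n)}\cdots\mathsf{P}_{\sigma(1)}\|_{\mathsf{op}}\le 1-\delta$. Then $$\left\|\frac1n\sum_{i=1}^n\mathsf{P}_i\right\|_{\mathsf{op}}\le 1-c\left(\frac{\delta}{n\log(n/\delta)}\right)^2.$$ 2. Suppose that there exists a permutation $\sigma:[n]\to[n]$ such that $\|\mathsf{P}_{\sigma(n)}\cdots\mathsf{P}_{\sigma(1)}\|_{\mathsf{op}}\le 1-\delta$. Then $$\left\|\frac1n\sum_{i=1}^n\mathsf{P}_i\right\|_{\mathsf{op}}\le 1-c\left(\frac{\delta}{n^2\log(n/\delta)}\right)^2.$$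
   Context: $[n]=\{1,\dots,n\}$. For a bounded linear operator $\mathsf{A}:\mathcal{H}\to\mathcal{H}$ on a Hilbert space $\mathcal{H}$, $\|\mathsf{A}\|_{\mathsf{op}}=\sup_{f\in\mathcal{H},\,f\neq0}\|\mathsf{A}f\|/\|f\|$, where $\|\cdot\|$ is the norm on $\mathcal{H}$ induced by the inner product. The constant $c$ is absolute, i.e. it does not depend on $\mathcal{H}$, $n$, the projections, or $\delta$.
   Formalization: The number of projections is assumed to satisfy n ≥ 2; for n = 1 the claim fails (P_1 = 0 and δ < 1 close to 1 make log(n/δ) tend to 0 and the right-hand side tend to −∞), and at δ = 1 it is undefined. *)

(* Defs.v *)
From HB Require Import structures.
From mathcomp Require Import all_boot all_order all_algebra all_fingroup.
From mathcomp Require Import sesquilinear.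
From mathcomp Require Import all_classical all_reals all_analysis.
From mathcomp Require Import complex.
Set Implicit Arguments.
Unset Strict Implicit.
Unset Printing Implicit Defensive.
Import Order.TTheory GRing.Theory Num.Theory.
Import numFieldNormedType.Exports.
Local Open Scope classical_set_scope.
Local Open Scope ring_scope.

(* Hilbert spaces are treated over both possible scalar fields at once. *)
Variant scalar_kind := RealScalars | ComplexScalars.

Definition scalars (R : realType) (k : scalar_kind) : numFieldType :=
  match k with
  | RealScalars => R
  | ComplexScalars => R[i]
  end.

Definition scalar_conj (R : realType) (k : scalar_kind) :
    scalars R k -> scalars R k :=
  match k with
  | RealScalars => idfun
  | ComplexScalars => @conjc R
  end.

(* Norms of vectors live in the scalar field, even when it is R[i]; this map
   reads them as real numbers. *)
Definition scalar_re (R : realType) (k : scalar_kind) : scalars R k -> R :=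
  match k with
  | RealScalars => idfun
  | ComplexScalars => @complex.Re R
  end.

Record hilbertSpace (R : realType) (k : scalar_kind) := HilbertSpace {
  hilbert_sort :> completeNormedModType (scalars R k);
  inner : {dot hilbert_sort for @scalar_conj R k};
  normr_inner : forall x : hilbert_sort, `|x| ^+ 2 = inner x x
}.

Definition orthogonal_projection (R : realType) (k : scalar_kind)
    (H : hilbertSpace R k) (P : {linear H -> H}) : Prop :=
  (forall x : H, P (P x) = P x) /\
  (forall x y : H, inner H (P x) y = inner H x (P y)).

(* [sup set0 = 0], so every operator on the zero space has norm 0. The
   supremum is only meaningful for bounded operators, since [sup] is also 0
   on unbounded sets. *)
Definition op_norm (R : realType) (k : scalar_kind) (H : hilbertSpace R k)
    (A : H -> H) : R :=
  sup [set scalar_re (`|A f| / `|f|) | f in [set f : H | f != 0]].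

(* P_{sigma(n)} o ... o P_{sigma(1)}: the factor of index sigma(1) is applied
   first, hence the reversal of indices. *)
Definition ordered_product (R : realType) (k : scalar_kind)
    (H : hilbertSpace R k) (n : nat) (P : 'I_n -> {linear H -> H})
    (sigma : 'S_n) : H -> H :=
  \big[comp/idfun]_(i < n) (P (sigma (rev_ord i)) : H -> H).

Definition average (R : realType) (k : scalar_kind) (H : hilbertSpace R k)
    (n : nat) (P : 'I_n -> {linear H -> H}) : H -> H :=
  fun f => n%:R^-1 *: \sum_(i < n) P i f.

(* Main.v *)
Require Import Defs.
From mathcomp Require Import all_boot all_order all_algebra all_fingroup.
From mathcomp Require Import all_classical all_reals all_analysis.
From mathcomp Require Import sesquilinear complex lra.
Import Order.TTheory GRing.Theory Num.Theory.
Import numFieldNormedType.Exports.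
Local Open Scope ring_scope.

(** Fix a nonzero vector [f] and put [a_i = |P_i f|], [d_i = |f - P_i f|], so
    that [a_i ^ 2 + d_i ^ 2 = |f| ^ 2] by Pythagoras.  If the average of the
    projections almost preserves the length of [f], then every [d_i] is small
    on average, hence no product of the projections can move [f] far.

    Quantitatively, the factors of a product are contractions, so replacing
    them by the identity one at a time gives
    [|f - P_sigma(n) ... P_sigma(1) f| <= \sum_i d_i], whatever [sigma] is
    ([comp_contractions_displacement]).  A product of norm at most
    [1 - delta] therefore forces [\sum_i d_i >= delta * |f|].  By
    Cauchy-Schwarz [\sum_i d_i ^ 2 >= delta ^ 2 * |f| ^ 2 / n], and
    [a_i <= |f| - d_i ^ 2 / (2 * |f|)] turns this into
    [|n^-1 \sum_i P_i f| <= (1 - delta ^ 2 / (2 * n ^ 2)) * |f|]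
    ([op_norm_average_le]).

    A single good permutation thus yields a loss of [(delta / n) ^ 2 / 2].
    Since [delta <= 1] and [n >= 2], the logarithm [ln (n / delta)] is at least
    [1 / 2], so [delta / (n * ln (n / delta))] is at most [2 * delta / n], and
    with [c = 1 / 8] both of the claimed losses are at most this one. *)

(** * Real parts of nonnegative scalars *)

Section ScalarRe.
Context {R : realType} {k : scalar_kind}.
Implicit Types a b : scalars R k.

Lemma scalar_reD a b : scalar_re (a + b) = scalar_re a + scalar_re b.
Proof. by case: k a b => //= -[? ?] [? ?]. Qed.

(** Over the complex numbers this holds because nonnegative scalars have zero
    imaginary part. *)
Lemma scalar_reM a b : 0 <= a -> 0 <= b ->
  scalar_re (a * b) = scalar_re a * scalar_re b.
Proof.
case: k a b => //= -[a1 a2] [b1 b2].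
by rewrite !lecE /= => /andP[/eqP -> _] /andP[/eqP -> _]; rewrite mulr0 subr0.
Qed.

Lemma scalar_re_le a b : a <= b -> scalar_re a <= scalar_re b.
Proof. by case: k a b => //= -[a1 a2] [b1 b2]; rewrite lecE => /andP[]. Qed.

Lemma scalar_re0 : scalar_re (0 : scalars R k) = 0.
Proof. by case: k. Qed.

Lemma scalar_re1 : scalar_re (1 : scalars R k) = 1.
Proof. by case: k. Qed.

Lemma scalar_re_nat n : scalar_re (n%:R : scalars R k) = n%:R.
Proof.
elim: n => [|n IH]; first exact: scalar_re0.
by rewrite !mulrS scalar_reD scalar_re1 IH.
Qed.

Lemma scalar_re_gt0 a : 0 < a -> 0 < scalar_re a.
Proof. by case: k a => //= -[a1 a2]; rewrite ltcE => /andP[]. Qed.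

Lemma scalar_reV a : 0 < a -> scalar_re a^-1 = (scalar_re a)^-1.
Proof.
move=> a0; have ra0 := scalar_re_gt0 a a0.
apply: (mulfI (lt0r_neq0 ra0)); rewrite divff ?lt0r_neq0//.
rewrite -scalar_reM ?invr_ge0 ?ltW// divff ?lt0r_neq0//; exact: scalar_re1.
Qed.
End ScalarRe.

(** * Vector norms and operator norms with real values *)

Section RealNorm.
Context {R : realType} {k : scalar_kind} {H : hilbertSpace R k}.
Implicit Types x y : H.

(** The norm of [H] takes values in the scalar field, which is only partially
    ordered in the complex case; its real version can be used in real
    inequalities for both kinds of scalars. *)
Definition real_norm x : R := scalar_re `|x|.

Lemma real_norm_ge0 x : 0 <= real_norm x.
Proof. by rewrite /real_norm -(@scalar_re0 R k) scalar_re_le. Qed.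

Lemma real_norm_gt0 x : x != 0 -> 0 < real_norm x.
Proof. by move=> x0; apply: scalar_re_gt0; rewrite normr_gt0. Qed.

Lemma real_norm0 : real_norm 0 = 0.
Proof. by rewrite /real_norm normr0 scalar_re0. Qed.

Lemma real_normD x y : real_norm (x + y) <= real_norm x + real_norm y.
Proof. by rewrite /real_norm -scalar_reD; apply/scalar_re_le/ler_normD. Qed.

Lemma real_norm_sum n (x : 'I_n -> H) :
  real_norm (\sum_i x i) <= \sum_i real_norm (x i).
Proof.
elim/big_rec2: _ => [|i s y _ le_ys]; first by rewrite real_norm0.
by apply: (le_trans (real_normD _ _)); rewrite lerD2l.
Qed.

Lemma real_norm_average n (P : 'I_n -> {linear H -> H}) f : (0 < n)%N ->
  real_norm (average P f) <= n%:R^-1 * \sum_i real_norm (P i f).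
Proof.
move=> n0; have n0' : 0 < n%:R :> scalars R k by rewrite ltr0n.
rewrite /real_norm /average normrZ (@scalar_reM R k)// normfV normr_nat.
rewrite scalar_reV// scalar_re_nat ler_wpM2l ?invr_ge0 ?ler0n//.
exact: real_norm_sum.
Qed.

Lemma scalar_re_norm_ratio (A : H -> H) f : f != 0 ->
  scalar_re (`|A f| / `|f|) = real_norm (A f) / real_norm f.
Proof.
by move=> f0; rewrite scalar_reM ?invr_ge0// scalar_reV// normr_gt0.
Qed.

(** The condition [0 <= b] is for the zero space, where [op_norm A] is [0]. *)
Lemma op_norm_le (A : H -> H) (b : R) : 0 <= b ->
  (forall f, real_norm (A f) <= b * real_norm f) -> op_norm A <= b.
Proof.
move=> b0 Ab; rewrite /op_norm; set S := (X in sup X).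
have [-> | /set0P S0] := eqVneq S set0; first by rewrite sup0.
apply: ge_sup => // _ [f /= f0 <-].
by rewrite scalar_re_norm_ratio// ler_pdivrMr ?real_norm_gt0.
Qed.

Lemma op_norm_ge0 (A : H -> H) : 0 <= op_norm A.
Proof.
rewrite /op_norm; set S := (X in sup X).
have [ubS | /sup_out->//] := pselect (has_sup S).
case: (ubS) => -[r Sr] ub; apply: le_trans (ub_le_sup ub Sr).
case: Sr => f /= f0 <-.
by rewrite scalar_re_norm_ratio// divr_ge0 ?real_norm_ge0.
Qed.

(** The supremum defining [op_norm A] is [0] when [A] is unbounded, so the
    inequality needs an a priori bound on [A]. *)
Lemma contraction_le_op_norm (A : H -> H) f :
  (forall g, real_norm (A g) <= real_norm g) -> f != 0 ->
  real_norm (A f) <= op_norm A * real_norm f.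
Proof.
move=> A1 f0; rewrite -ler_pdivrMr ?real_norm_gt0// -scalar_re_norm_ratio//.
apply: ub_le_sup; last by exists f.
exists 1 => _ [g /= g0 <-].
by rewrite scalar_re_norm_ratio// ler_pdivrMr ?real_norm_gt0// mul1r.
Qed.

(** * Contractions and orthogonal projections *)

(** Idempotence and symmetry give [(P x, x) = (P x, P x) = (x, P x)], so that
    [x - P x] is orthogonal to [P x]. *)
Lemma projection_pythagoras (P : {linear H -> H}) x :
  orthogonal_projection P ->
  real_norm (P x) ^+ 2 + real_norm (x - P x) ^+ 2 = real_norm x ^+ 2.
Proof.
move=> [idP symP].
have sq y : real_norm y ^+ 2 = scalar_re (inner H y y).
  by rewrite -normr_inner expr2 scalar_reM.
rewrite !sq -scalar_reD; congr scalar_re.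
have e1 : inner H (P x) x = inner H (P x) (P x) by rewrite -symP idP.
have e2 : inner H x (P x) = inner H (P x) (P x) by rewrite symP idP.
rewrite linearBl !linearBr /= e1 e2.
by rewrite subrr subr0 addrC subrK.
Qed.

Lemma projection_contraction (P : {linear H -> H}) x :
  orthogonal_projection P -> real_norm (P x) <= real_norm x.
Proof.
move=> projP; rewrite -ler_sqr ?nnegrE ?real_norm_ge0//.
by rewrite -(projection_pythagoras P x projP) lerDl sqr_ge0.
Qed.

Section Contractions.
Context {I : Type} (Q : I -> {linear H -> H}).
Context (Q1 : forall i x, real_norm (Q i x) <= real_norm x).

Lemma comp_contractions (r : seq I) x :
  real_norm ((\big[comp/idfun]_(i <- r) (Q i : H -> H)) x) <= real_norm x.
Proof.
elim: r => [|i r IH]; first by rewrite big_nil.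
by rewrite big_cons /=; apply: le_trans (Q1 _ _) IH.
Qed.

(** Peeling off the outermost factor, [f - Q (g f)] is
    [(f - Q f) + Q (f - g f)], and [Q] does not increase the length of the
    second summand. *)
Lemma comp_contractions_displacement (r : seq I) f :
  real_norm (f - (\big[comp/idfun]_(i <- r) (Q i : H -> H)) f)
    <= \sum_(i <- r) real_norm (f - Q i f).
Proof.
elim: r => [|i r IH]; first by rewrite !big_nil subrr real_norm0.
rewrite !big_cons /=; set g := \big[_/_]_(_ <- _) _ in IH *.
have -> : f - Q i (g f) = (f - Q i f) + Q i (f - g f).
  by rewrite linearB /= addrA subrK.
apply: (le_trans (real_normD _ _)); rewrite lerD2l.
exact: le_trans (Q1 _ _) IH.
Qed.
End Contractions.
End RealNorm.

(** * Products and averages of orthogonal projections *)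

Section ProjectionFamily.
Context {R : realType} {k : scalar_kind} {H : hilbertSpace R k} {n : nat}.
Context (P : 'I_n -> {linear H -> H}).
Context (projP : forall i, orthogonal_projection (P i)).

Lemma ordered_product_contraction (sigma : 'S_n) f :
  real_norm (ordered_product P sigma f) <= real_norm f.
Proof.
apply: (comp_contractions (fun i => P (sigma (rev_ord i)))) => i x.
exact: projection_contraction.
Qed.

Lemma ordered_product_displacement (sigma : 'S_n) f :
  real_norm (f - ordered_product P sigma f)
    <= \sum_i real_norm (f - P i f).
Proof.
rewrite (reindex_inj (@perm_inj _ sigma)) (reindex_inj rev_ord_inj) /=.
apply: (comp_contractions_displacement
  (fun i => P (sigma (rev_ord i)))) => i x.
exact: projection_contraction.
Qed.

Lemma sum_displacement_ge (sigma : 'S_n) (delta : R) f :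
  op_norm (ordered_product P sigma) <= 1 - delta -> f != 0 ->
  delta * real_norm f <= \sum_i real_norm (f - P i f).
Proof.
move=> le_delta f0.
apply: le_trans (ordered_product_displacement sigma f).
have le_prod : real_norm (ordered_product P sigma f)
    <= (1 - delta) * real_norm f.
  apply: (le_trans (contraction_le_op_norm _ _
    (ordered_product_contraction sigma) f0)).
  by rewrite ler_wpM2r ?real_norm_ge0.
have := real_normD (f - ordered_product P sigma f) (ordered_product P sigma f).
rewrite subrK => tri; lra.
Qed.

Lemma op_norm_average_le (sigma : 'S_n) (delta : R) : (0 < n)%N ->
  0 <= delta -> op_norm (ordered_product P sigma) <= 1 - delta ->
  op_norm (average P) <= 1 - (delta / n%:R) ^+ 2 / 2.
Proof.
move=> n0 delta0 le_delta.
have nR0 : 0 < n%:R :> R by rewrite ltr0n.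
set t := delta / n%:R.
have tn : t * n%:R = delta by rewrite divfK ?gt_eqF.
have t0 : 0 <= t := divr_ge0 delta0 (ltW nR0).
have delta1 : delta <= 1 by have := op_norm_ge0 (ordered_product P sigma); lra.
have t1 : t <= 1.
  by rewrite ler_pdivrMr// mul1r; apply: (le_trans delta1); rewrite ler1n.
apply: op_norm_le => [|f]; first by nra.
have [-> | f0] := eqVneq f 0.
  rewrite real_norm0 mulr0.
  apply: (le_trans (real_norm_average n P 0 n0)).
  by rewrite big1 ?mulr0// => i _; rewrite linear0 real_norm0.
apply: (le_trans (real_norm_average n P f n0)); rewrite ler_pdivrMl//.
have F0 := real_norm_gt0 f f0; set F := real_norm f in F0 *.
(* Cauchy-Schwarz enters through the tangent line of [d ^ 2] at [d = t * F],
   the common value of the [d_i] in the extremal case: being linear in [d],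
   [2 * (t * F) * d - (t * F) ^ 2 <= d ^ 2] can be summed over [i]. *)
have le_proj i : real_norm (P i f)
    <= F + t ^+ 2 * F / 2 - t * real_norm (f - P i f).
  have := projection_pythagoras (P i) f (projP i).
  rewrite -/F; set a := real_norm (P i f); set d := real_norm _ => pyth.
  rewrite -(ler_pM2l F0).
  have := sqr_ge0 (F - a); have := sqr_ge0 (d - t * F); nra.
apply: (le_trans (ler_sum _ (fun i _ => le_proj i))).
rewrite sumrB -mulr_sumr sumr_const card_ord -mulr_natl.
have := sum_displacement_ge sigma delta f le_delta f0; rewrite -/F -tn => disp.
have := ler_wpM2l t0 disp; nra.
Qed.
End ProjectionFamily.

(** * Comparison with the logarithmic loss *)

(** The bound [ln 2 >= 1 / 2] comes from [ln (1 / 2) <= 1 / 2 - 1]. *)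
Lemma ln_ratio_ge_half (R : realType) (n : nat) (delta : R) : (2 <= n)%N ->
  0 < delta -> delta <= 1 -> 1 / 2 <= ln (n%:R / delta).
Proof.
move=> n2 delta0 delta1.
have n2R : 2 <= n%:R :> R by rewrite (ler_nat _ 2).
have le2 : 2 <= n%:R / delta by rewrite ler_pdivlMr//; nra.
apply: (@le_trans _ _ (ln 2)); last by rewrite ler_ln ?posrE//; lra.
have := @le_ln1Dx R (- (1 / 2)); rewrite (_ : 1 + _ = 2^-1); last by lra.
by rewrite lnV ?posrE//; lra.
Qed.

Lemma log_loss_le (R : realType) (n m delta L : R) :
  0 < n -> n <= m -> 0 <= delta -> 1 / 2 <= L ->
  1 / 8 * (delta / (m * L)) ^+ 2 <= (delta / n) ^+ 2 / 2.
Proof.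
move=> n0 nm delta0 L2.
have m0 : 0 < m by lra.
have nmL : n / 2 <= m * L by nra.
have ge0 : 0 <= delta / (m * L) by rewrite divr_ge0//; nra.
have le2 : delta / (m * L) <= 2 * (delta / n).
  rewrite mulrCA ler_wpM2l// -(invrK 2) -invfM lef_pV2 ?posrE//; nra.
have := lerXn2r 2 _ _ le2; rewrite !nnegrE => /(_ ge0 (le_trans ge0 le2)).
rewrite exprMn; lra.
Qed.

Theorem theorem3p3 (R : realType) :
  exists c : R, 0 < c /\
    forall (k : scalar_kind) (H : hilbertSpace R k) (n : nat)
      (P : 'I_n -> {linear H -> H}) (delta : R),
      (2 <= n)%N ->
      (forall i : 'I_n, orthogonal_projection (P i)) ->
      0 < delta ->
      ((forall sigma : 'S_n, op_norm (ordered_product P sigma) <= 1 - delta) ->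
        op_norm (average P)
          <= 1 - c * (delta / (n%:R * ln (n%:R / delta))) ^+ 2) /\
      ((exists sigma : 'S_n, op_norm (ordered_product P sigma) <= 1 - delta) ->
        op_norm (average P)
          <= 1 - c * (delta / (n%:R ^+ 2 * ln (n%:R / delta))) ^+ 2).
Proof.
exists (1 / 8); split => [|k H n P delta n2 projP delta0]; first by lra.
have nR1 : 1 <= n%:R :> R by rewrite ler1n (leq_trans _ n2).
have loss (m : R) (sigma : 'S_n) : n%:R <= m ->
    op_norm (ordered_product P sigma) <= 1 - delta ->
    op_norm (average P)
      <= 1 - 1 / 8 * (delta / (m * ln (n%:R / delta))) ^+ 2.
  move=> nm le_delta.
  have delta1 : delta <= 1.
    by have := op_norm_ge0 (ordered_product P sigma); lra.
  apply: (le_trans (op_norm_average_le P projP sigma delta (ltnW n2)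
    (ltW delta0) le_delta)).
  rewrite lerD2l lerN2; apply: log_loss_le => //; [lra | exact: ltW |].
  exact: ln_ratio_ge_half.
split=> [le_delta | [sigma le_delta]].
  exact: loss (le_delta 1%g).
by apply: loss le_delta; rewrite expr2 ler_peMr//; lra.
Qed.
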